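(* Let $(A,\cdot,[-,-],\varepsilon)$ be a non-commutative Leibniz-Poisson color algebra. Then $(A,\cdot,\{-,-,-\},\varepsilon)$ is a non-commutative ternary Leibniz-Nambu-Poisson color algebra, with $$\{x,y,z\}:=[x,y\cdot z]$$ for all $x,y,z\in\mathcal{H}(A)$.
   Context: $\mathbb{K}$ is a field of characteristic different from 2 and $G$ is an abelian group. A bicharacter is a map $\varepsilon:G\times G\to\mathbb{K}^*$ with $\varepsilon(a,b)\varepsilon(b,a)=1$, $\varepsilon(a,b+c)=\varepsilon(a,b)\varepsilon(a,c)$, $\varepsilon(a+b,c)=\varepsilon(a,c)\varepsilon(b,c)$. For a $G$-graded vector space $V=\bigoplus_{a\in G}V_a$ over $\mathbb{K}$, $\mathcal{H}(V)$ denotes the set of homogeneous elements. For homogeneous $x,y,z$ one writes $\varepsilon(x,y)$ for $\varepsilon(\deg x,\deg y)$, $\varepsilon(x,y+z)$ for $\varepsilon(\deg x,\deg y+\deg z)$, etc. A multilinear map is even if the degree of its value on homogeneous elements is the sum of their degrees. A non-commutative Leibniz-Poisson color algebra is a quadruple $(P,\cdot,[-,-],\varepsilon)$, with $P$ a $G$-graded vector space, $\cdot$ and $[-,-]$ even bilinear maps $P\otimes P\to P$ and $\varepsilon$ a bicharacter, such that for all $x,y,z\in\mathcal{H}(P)$: $(x\cdot y)\cdot z=x\cdot(y\cdot z)$; $[[x,y],z]=[x,[y,z]]+\varepsilon(y,z)[[x,z],y]$; $[x\cdot y,z]=x\cdot[y,z]+\varepsilon(y,z)[x,z]\cdot y$.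 A non-commutative ternary Leibniz-Nambu-Poisson color algebra is a quadruple $(A,\cdot,[-,-,-],\varepsilon)$, with $A$ a $G$-graded vector space, $\cdot$ even bilinear, $[-,-,-]$ even trilinear and $\varepsilon$ a bicharacter, such that for all $x,y,z,t,u\in\mathcal{H}(A)$: 1) $(x\cdot y)\cdot z=x\cdot(y\cdot z)$; 2) $[[x,y,z],t,u]=[x,y,[z,t,u]]+\varepsilon(z,t+u)[x,[y,t,u],z]+\varepsilon(y+z,t+u)[[x,t,u],y,z]$; 3) $[x\cdot y,z,t]=x\cdot[y,z,t]+\varepsilon(y,z+t)[x,z,t]\cdot y$. *)

(* Defs.v *)
From mathcomp Require Import all_boot all_algebra.
From mathcomp Require Import classical_sets functions cardinality fsbigop.

Set Implicit Arguments.
Unset Strict Implicit.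
Unset Printing Implicit Defensive.

Import GRing.Theory.

Local Open Scope classical_set_scope.
Local Open Scope ring_scope.

Record bicharacter (K : fieldType) (G : zmodType) (eps : G -> G -> K) : Prop :=
  Bicharacter {
    bichar_neq0 : forall a b, eps a b != 0;
    bichar_skew : forall a b, eps a b * eps b a = 1;
    bichar_addr : forall a b c, eps a (b + c) = eps a b * eps a c;
    bichar_addl : forall a b c, eps (a + b) c = eps a c * eps b c
  }.

Section Graded.

Variables (K : fieldType) (G : zmodType) (V : lmodType K) (V_ : G -> set V).

(* Internal direct sum. The finiteness clause is needed because [\sum_(a \in D)]
   is 0 by convention on families of infinite support. *)
Record graded : Prop := Graded {
  graded_submod : forall a, submod_closed (mem (V_ a));
  graded_direct_sum : forall v : V, exists! f : G -> V,
    [/\ forall a, V_ a (f a),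
        finite_set [set a | f a != 0]
      & v = \sum_(a \in [set: G]) f a]
}.

Definition even2 (m : V -> V -> V) : Prop :=
  forall a b x y, V_ a x -> V_ b y -> V_ (a + b) (m x y).

Definition even3 (t : V -> V -> V -> V) : Prop :=
  forall a b c x y z,
    V_ a x -> V_ b y -> V_ c z -> V_ (a + b + c) (t x y z).

Definition bilinear2 (m : V -> V -> V) : Prop :=
  (forall y, linear (fun x => m x y)) /\ (forall x, linear (m x)).

Definition trilinear (t : V -> V -> V -> V) : Prop :=
  [/\ forall y z, linear (fun x => t x y z),
      forall x z, linear (fun y => t x y z)
    & forall x y, linear (t x y)].

(* A homogeneous element is given together with a degree; 0 has all degrees. *)

Record nc_leibniz_poisson_color_algebra
    (mul br : V -> V -> V) (eps : G -> G -> K) : Prop := NCLeibnizPoissonColor {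
  nclp_graded : graded;
  nclp_mul_bilinear : bilinear2 mul;
  nclp_mul_even : even2 mul;
  nclp_br_bilinear : bilinear2 br;
  nclp_br_even : even2 br;
  nclp_bichar : bicharacter eps;
  nclp_assoc : forall a b c x y z, V_ a x -> V_ b y -> V_ c z ->
    mul (mul x y) z = mul x (mul y z);
  nclp_leibniz : forall a b c x y z, V_ a x -> V_ b y -> V_ c z ->
    br (br x y) z = br x (br y z) + eps b c *: br (br x z) y;
  nclp_compat : forall a b c x y z, V_ a x -> V_ b y -> V_ c z ->
    br (mul x y) z = mul x (br y z) + eps b c *: mul (br x z) y
}.

Record nc_ternary_leibniz_nambu_poisson_color_algebra
    (mul : V -> V -> V) (tbr : V -> V -> V -> V) (eps : G -> G -> K) : Prop :=
  NCTernaryLeibnizNambuPoissonColor {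
  nctlnp_graded : graded;
  nctlnp_mul_bilinear : bilinear2 mul;
  nctlnp_mul_even : even2 mul;
  nctlnp_tbr_trilinear : trilinear tbr;
  nctlnp_tbr_even : even3 tbr;
  nctlnp_bichar : bicharacter eps;
  nctlnp_assoc : forall a b c x y z, V_ a x -> V_ b y -> V_ c z ->
    mul (mul x y) z = mul x (mul y z);
  nctlnp_nambu : forall a b c d e x y z t u,
    V_ a x -> V_ b y -> V_ c z -> V_ d t -> V_ e u ->
    tbr (tbr x y z) t u =
      tbr x y (tbr z t u)
      + eps c (d + e) *: tbr x (tbr y t u) z
      + eps (b + c) (d + e) *: tbr (tbr x t u) y z;
  nctlnp_compat : forall a b c d x y z t,
    V_ a x -> V_ b y -> V_ c z -> V_ d t ->
    tbr (mul x y) z t =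
      mul x (tbr y z t) + eps b (c + d) *: mul (tbr x z t) y
}.

End Graded.

(* Main.v *)
Require Import Defs.
From mathcomp Require Import all_boot all_algebra.
From mathcomp Require Import classical_sets functions cardinality fsbigop.

(** The product is even, so w = t * u is homogeneous of degree d + e when t and
    u have degrees d and e; the ternary bracket {x, t, u} is therefore the
    binary bracket br x w with a homogeneous second argument, and the ternary
    identities are instances of the binary ones.

    For the fundamental identity, with y and z of degrees b and c, the Leibniz
    identity gives
      br (br x (y * z)) w
        = br x (br (y * z) w) + eps (b + c) (d + e) br (br x w) (y * z),
    and the compatibility of the bracket with the product gives
      br (y * z) w = y * br z w + eps c (d + e) (br y w) * z.
    Applying br x to the second formula yields the two terms {x, y, {z, t, u}}
    and {x, {y, t, u}, z}. The ternary compatibility is the binary one, with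
    the product of the last two entries as third argument. *)

Set Implicit Arguments.
Unset Strict Implicit.
Unset Printing Implicit Defensive.

Import GRing.Theory.

Local Open Scope ring_scope.

Theorem theorem4p8 (K : fieldType) (charK : 2%N \notin [pchar K])
    (G : zmodType) (A : lmodType K) (A_ : G -> set A)
    (mul br : A -> A -> A) (eps : G -> G -> K) :
  nc_leibniz_poisson_color_algebra A_ mul br eps ->
  nc_ternary_leibniz_nambu_poisson_color_algebra A_ mul
    (fun x y z => br x (mul y z)) eps.
Proof.
case=> grA [mulDl mulDr] mulE [brDl brDr] brE epsP mulA leib compat.
split=> //.
- split=> [y z|x z|x y] k u v; first exact: brDl.
  + by rewrite mulDl brDr.
  + by rewrite mulDr brDr.
- move=> a b c x y z Ax Ay Az; rewrite -addrA.
  exact: brE Ax (mulE _ _ _ _ Ay Az).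
- move=> a b c d e x y z t u Ax Ay Az At Au.
  have Aw := mulE _ _ _ _ At Au.
  rewrite (leib _ _ _ _ _ _ Ax (mulE _ _ _ _ Ay Az) Aw).
  congr (_ + _); rewrite (compat _ _ _ _ _ _ Ay Az Aw).
  (* Linearity is stated for [k *: u + v], with the scaled term first. *)
  by rewrite addrC brDr addrC.
- move=> a b c d x y z t Ax Ay Az At.
  exact: compat Ax Ay (mulE _ _ _ _ Az At).
Qed.
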